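(* Let $\big((\mathfrak{g},[\cdot,\cdot]_\mathfrak{g},N),(\mathfrak{h},[\cdot,\cdot]_\mathfrak{h},S),\rho,\nu\big)$ be a matched pair of Nijenhuis Lie algebras. Then $\big((\mathfrak{g},\diamond_N,\lfloor\cdot,\cdot\rfloor_N),(\mathfrak{h},\diamond_S,\lfloor\cdot,\cdot\rfloor_S),l,r,\psi,L,R,\Psi\big)$ is a matched pair of (induced) NS-Lie algebras, where $l,r,\psi:\mathfrak{g}\to\mathrm{End}(\mathfrak{h})$ and $L,R,\Psi:\mathfrak{h}\to\mathrm{End}(\mathfrak{g})$ are given by $$l_xh=\rho_{N(x)}h,\quad r_xh=-\rho_xS(h),\quad\psi_xh=-S(\rho_xh),$$ $$L_hx=\nu_{S(h)}x,\quad R_hx=-\nu_hN(x),\quad\Psi_hx=-N(\nu_hx).$$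
   Context: A Nijenhuis Lie algebra $(\mathfrak{g},[\cdot,\cdot]_\mathfrak{g},N)$ is a Lie algebra with a linear map $N$ satisfying $[Nx,Ny]_\mathfrak{g}=N([Nx,y]_\mathfrak{g}+[x,Ny]_\mathfrak{g}-N[x,y]_\mathfrak{g})$. A Nijenhuis representation of it is $(\mathcal{V},\rho,S)$ with $(\mathcal{V},\rho)$ a Lie algebra representation and $S:\mathcal{V}\to\mathcal{V}$ linear with $\rho_{Nx}S(v)=S(\rho_{Nx}v+\rho_xS(v)-S(\rho_xv))$. A matched pair of Nijenhuis Lie algebras $((\mathfrak{g},[\cdot,\cdot]_\mathfrak{g},N),(\mathfrak{h},[\cdot,\cdot]_\mathfrak{h},S),\rho,\nu)$ consists of two Nijenhuis Lie algebras and linear maps $\rho:\mathfrak{g}\to\mathrm{End}(\mathfrak{h})$, $\nu:\mathfrak{h}\to\mathrm{End}(\mathfrak{g})$ such that $(\mathfrak{h},\rho,S)$ is a Nijenhuis representation of $(\mathfrak{g},[\cdot,\cdot]_\mathfrak{g},N)$, $(\mathfrak{g},\nu,N)$ is a Nijenhuis representation of $(\mathfrak{h},[\cdot,\cdot]_\mathfrak{h},S)$, and $\rho_x[h,k]_\mathfrak{h}=[\rho_xh,k]_\mathfrak{h}+[h,\rho_xk]_\mathfrak{h}+\rho_{\nu_kx}h-\rho_{\nu_hx}k$, $\nu_h[x,y]_\mathfrak{g}=[\nu_hx,y]_\mathfrak{g}+[x,\nu_hy]_\mathfrak{g}+\nu_{\rho_yh}x-\nu_{\rho_xh}y$. An NS-Lie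 algebra $(\mathfrak{p},\diamond,\lfloor\cdot,\cdot\rfloor)$ is a vector space with bilinear operations $\diamond$ and $\lfloor\cdot,\cdot\rfloor$, the latter antisymmetric, such that, with $\llbracket x,y\rrbracket:=x\diamond y-y\diamond x+\lfloor x,y\rfloor$, $(x\diamond y)\diamond z-x\diamond(y\diamond z)+\lfloor x,y\rfloor\diamond z=(y\diamond x)\diamond z-y\diamond(x\diamond z)$ and $\lfloor x,\llbracket y,z\rrbracket\rfloor+\lfloor y,\llbracket z,x\rrbracket\rfloor+\lfloor z,\llbracket x,y\rrbracket\rfloor+x\diamond\lfloor y,z\rfloor+y\diamond\lfloor z,x\rfloor+z\diamond\lfloor x,y\rfloor=0$. A Nijenhuis Lie algebra $(\mathfrak{g},[\cdot,\cdot]_\mathfrak{g},N)$ induces the NS-Lie algebra $(\mathfrak{g},\diamond_N,\lfloor\cdot,\cdot\rfloor_N)$ with $x\diamond_Ny=[N(x),y]_\mathfrak{g}$, $\lfloor x,y\rfloor_N=-N[x,y]_\mathfrak{g}$ (similarly for $(\mathfrak{h},[\cdot,\cdot]_\mathfrak{h},S)$). A representation of an NS-Lie algebra $(\mathfrak{p},\diamond,\lfloor\cdot,\cdot\rfloor)$ is $(\mathcal{V},l,r,\psi)$ with linear maps $l,r,\psi:\mathfrak{p}\to\mathrm{End}(\mathcal{V})$ such that $l_{x\diamond y}-l_xl_y+l_{\lfloor x,y\rfloor}=l_{y\diamond x}-l_yl_x$; $r_{x\diamond y}-r_yr_x+r_y\psi_x=l_xr_y-r_yl_x$; $\psi_{\llbracket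 x,y\rrbracket}-r_{\lfloor x,y\rfloor}=l_x\psi_y-l_y\psi_x+\psi_x(l_y-r_y+\psi_y)-\psi_y(l_x-r_x+\psi_x)$. A matched pair of NS-Lie algebras $((\mathfrak{p}_1,\diamond_1,\lfloor\cdot,\cdot\rfloor_1),(\mathfrak{p}_2,\diamond_2,\lfloor\cdot,\cdot\rfloor_2),l,r,\psi,L,R,\Psi)$ consists of two NS-Lie algebras and linear maps $l,r,\psi:\mathfrak{p}_1\to\mathrm{End}(\mathfrak{p}_2)$, $L,R,\Psi:\mathfrak{p}_2\to\mathrm{End}(\mathfrak{p}_1)$ such that $(\mathfrak{p}_2,l,r,\psi)$ is a representation of $\mathfrak{p}_1$, $(\mathfrak{p}_1,L,R,\Psi)$ is a representation of $\mathfrak{p}_2$, and for all $x,y\in\mathfrak{p}_1$, $\alpha,\beta\in\mathfrak{p}_2$, writing $\theta_x=l_x-r_x+\psi_x$ and $\Theta_\alpha=L_\alpha-R_\alpha+\Psi_\alpha$, and $\llbracket\cdot,\cdot\rrbracket_i$ for the bracket $\llbracket\cdot,\cdot\rrbracket$ of $\mathfrak{p}_i$: $l_x(\alpha\diamond_2\beta)=(l_x\alpha)\diamond_2\beta+\alpha\diamond_2(l_x\beta)+(\psi_x\alpha)\diamond_2\beta-(r_x\alpha)\diamond_2\beta+r_{R_\beta x}\alpha-l_{\Theta_\alpha x}\beta$; $r_x(\llbracket\alpha,\beta\rrbracket_2)=\alpha\diamond_2r_x\beta-\beta\diamond_2r_x\alpha+r_{L_\beta x}\alpha-r_{L_\alpha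 x}\beta$; $L_\alpha(x\diamond_1y)=(L_\alpha x)\diamond_1y+x\diamond_1(L_\alpha y)+(\Psi_\alpha x)\diamond_1y-(R_\alpha x)\diamond_1y+R_{r_y\alpha}x-L_{\theta_x\alpha}y$; $R_\alpha(\llbracket x,y\rrbracket_1)=x\diamond_1R_\alpha y-y\diamond_1R_\alpha x+R_{l_y\alpha}x-R_{l_x\alpha}y$; $l_x(\lfloor\alpha,\beta\rfloor_2)=\lfloor\theta_x\alpha,\beta\rfloor_2+\lfloor\alpha,\theta_x\beta\rfloor_2+\psi_{\Theta_\beta x}\alpha-\psi_{\Theta_\alpha x}\beta+\alpha\diamond_2\psi_x\beta-\beta\diamond_2\psi_x\alpha+r_{\Psi_\alpha x}\beta-r_{\Psi_\beta x}\alpha-\psi_x\llbracket\alpha,\beta\rrbracket_2$; $L_\alpha(\lfloor x,y\rfloor_1)=\lfloor\Theta_\alpha x,y\rfloor_1+\lfloor x,\Theta_\alpha y\rfloor_1+\Psi_{\theta_y\alpha}x-\Psi_{\theta_x\alpha}y+x\diamond_1\Psi_\alpha y-y\diamond_1\Psi_\alpha x+R_{\psi_x\alpha}y-R_{\psi_y\alpha}x-\Psi_\alpha\llbracket x,y\rrbracket_1$. *)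

(* Defs.v *)
From HB Require Import structures.
From mathcomp Require Import all_boot all_order all_algebra.

Set Implicit Arguments.
Unset Strict Implicit.
Unset Printing Implicit Defensive.

Import GRing.Theory.
Local Open Scope ring_scope.

(* All predicates below are stated for operations on left modules over a field
   K, of arbitrary dimension and characteristic.  A linear map U -> End(V) is
   given in uncurried form, as a bilinear map U -> V -> V.  Lie brackets are
   required to be alternating, which is stronger than antisymmetric only in
   characteristic 2; the bracket of an NS-Lie algebra is only antisymmetric. *)
Notation bilinear_op f := (bilinear_for *:%R *:%R f).

Section Lie.
Variable K : fieldType.

Record lie_algebra (g : lmodType K) (br : g -> g -> g) : Prop := {
  lie_bilinear : bilinear_op br;
  lie_alternating : forall x, br x x = 0;
  lie_jacobi : forall x y z,
    br x (br y z) + br y (br z x) + br z (br x y) = 0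
}.

Record lie_representation (g : lmodType K) (br : g -> g -> g)
    (V : lmodType K) (rho : g -> V -> V) : Prop := {
  lie_rep_bilinear : bilinear_op rho;
  lie_rep_bracket : forall x y v,
    rho (br x y) v = rho x (rho y v) - rho y (rho x v)
}.

Record nijenhuis_lie_algebra (g : lmodType K) (br : g -> g -> g)
    (N : g -> g) : Prop := {
  nij_lie : lie_algebra br;
  nij_linear : linear N;
  nij_eq : forall x y,
    br (N x) (N y) = N (br (N x) y + br x (N y) - N (br x y))
}.

Record nijenhuis_representation (g : lmodType K) (br : g -> g -> g)
    (N : g -> g) (V : lmodType K) (rho : g -> V -> V) (S : V -> V) : Prop := {
  nij_rep_lie : lie_representation br rho;
  nij_rep_linear : linear S;
  nij_rep_eq : forall x v,
    rho (N x) (S v) = S (rho (N x) v + rho x (S v) - S (rho x v))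
}.

Record nijenhuis_matched_pair (g h : lmodType K)
    (brg : g -> g -> g) (N : g -> g) (brh : h -> h -> h) (S : h -> h)
    (rho : g -> h -> h) (nu : h -> g -> g) : Prop := {
  nij_mp_left : nijenhuis_lie_algebra brg N;
  nij_mp_right : nijenhuis_lie_algebra brh S;
  nij_mp_rho : nijenhuis_representation brg N rho S;
  nij_mp_nu : nijenhuis_representation brh S nu N;
  nij_mp_rho_bracket : forall (x : g) (a b : h),
    rho x (brh a b) =
      brh (rho x a) b + brh a (rho x b) + rho (nu b x) a - rho (nu a x) b;
  nij_mp_nu_bracket : forall (a : h) (x y : g),
    nu a (brg x y) =
      brg (nu a x) y + brg x (nu a y) + nu (rho y a) x - nu (rho x a) y
}.

End Lie.

Section NSLie.
Variable K : fieldType.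

Definition ns_bracket (p : lmodType K) (dia flo : p -> p -> p) (x y : p) : p :=
  dia x y - dia y x + flo x y.

Record ns_lie_algebra (p : lmodType K) (dia flo : p -> p -> p) : Prop := {
  ns_dia_bilinear : bilinear_op dia;
  ns_flo_bilinear : bilinear_op flo;
  ns_flo_antisym : forall x y, flo x y = - flo y x;
  ns_dia_eq : forall x y z,
    dia (dia x y) z - dia x (dia y z) + dia (flo x y) z =
      dia (dia y x) z - dia y (dia x z);
  ns_flo_eq : forall x y z,
    flo x (ns_bracket dia flo y z) + flo y (ns_bracket dia flo z x)
      + flo z (ns_bracket dia flo x y)
      + dia x (flo y z) + dia y (flo z x) + dia z (flo x y) = 0
}.

Definition ns_theta (p V : lmodType K) (l r psi : p -> V -> V)
    (x : p) (v : V) : V :=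
  l x v - r x v + psi x v.

Record ns_representation (p : lmodType K) (dia flo : p -> p -> p)
    (V : lmodType K) (l r psi : p -> V -> V) : Prop := {
  ns_rep_l_bilinear : bilinear_op l;
  ns_rep_r_bilinear : bilinear_op r;
  ns_rep_psi_bilinear : bilinear_op psi;
  ns_rep_l_eq : forall x y v,
    l (dia x y) v - l x (l y v) + l (flo x y) v = l (dia y x) v - l y (l x v);
  ns_rep_r_eq : forall x y v,
    r (dia x y) v - r y (r x v) + r y (psi x v) = l x (r y v) - r y (l x v);
  ns_rep_psi_eq : forall x y v,
    psi (ns_bracket dia flo x y) v - r (flo x y) v =
      l x (psi y v) - l y (psi x v)
        + psi x (ns_theta l r psi y v) - psi y (ns_theta l r psi x v)
}.

Record ns_matched_pair (p1 p2 : lmodType K)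
    (dia1 flo1 : p1 -> p1 -> p1) (dia2 flo2 : p2 -> p2 -> p2)
    (l r psi : p1 -> p2 -> p2) (L R Psi : p2 -> p1 -> p1) : Prop := {
  ns_mp_left : ns_lie_algebra dia1 flo1;
  ns_mp_right : ns_lie_algebra dia2 flo2;
  ns_mp_rep_left : ns_representation dia1 flo1 l r psi;
  ns_mp_rep_right : ns_representation dia2 flo2 L R Psi;
  ns_mp_l_dia : forall (x : p1) (a b : p2),
    l x (dia2 a b) =
      dia2 (l x a) b + dia2 a (l x b) + dia2 (psi x a) b - dia2 (r x a) b
        + r (R b x) a - l (ns_theta L R Psi a x) b;
  ns_mp_r_bracket : forall (x : p1) (a b : p2),
    r x (ns_bracket dia2 flo2 a b) =
      dia2 a (r x b) - dia2 b (r x a) + r (L b x) a - r (L a x) b;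
  ns_mp_L_dia : forall (a : p2) (x y : p1),
    L a (dia1 x y) =
      dia1 (L a x) y + dia1 x (L a y) + dia1 (Psi a x) y - dia1 (R a x) y
        + R (r y a) x - L (ns_theta l r psi x a) y;
  ns_mp_R_bracket : forall (a : p2) (x y : p1),
    R a (ns_bracket dia1 flo1 x y) =
      dia1 x (R a y) - dia1 y (R a x) + R (l y a) x - R (l x a) y;
  ns_mp_l_flo : forall (x : p1) (a b : p2),
    l x (flo2 a b) =
      flo2 (ns_theta l r psi x a) b + flo2 a (ns_theta l r psi x b)
        + psi (ns_theta L R Psi b x) a - psi (ns_theta L R Psi a x) b
        + dia2 a (psi x b) - dia2 b (psi x a)
        + r (Psi a x) b - r (Psi b x) a
        - psi x (ns_bracket dia2 flo2 a b);
  ns_mp_L_flo : forall (a : p2) (x y : p1),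
    L a (flo1 x y) =
      flo1 (ns_theta L R Psi a x) y + flo1 x (ns_theta L R Psi a y)
        + Psi (ns_theta l r psi y a) x - Psi (ns_theta l r psi x a) y
        + dia1 x (Psi a y) - dia1 y (Psi a x)
        + R (psi x a) y - R (psi y a) x
        - Psi a (ns_bracket dia1 flo1 x y)
}.

Definition nij_dia (g : lmodType K) (br : g -> g -> g) (N : g -> g)
    (x y : g) : g :=
  br (N x) y.

Definition nij_flo (g : lmodType K) (br : g -> g -> g) (N : g -> g)
    (x y : g) : g :=
  - N (br x y).

End NSLie.

(* Main.v *)
Require Import Defs.
From HB Require Import structures.
From mathcomp Require Import all_boot all_order all_algebra.

(** Write [x, y]_N = [N x, y] + [x, N y] - N [x, y] for the deformed bracket of
    a Nijenhuis Lie algebra, and theta_x v = rho_(N x) v + rho_x (S v)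
    - S (rho_x v) for the corresponding deformation of a representation.  These
    are the total bracket of the induced NS-Lie algebra and the combination
    l_x - r_x + psi_x of the induced representation, and the Nijenhuis identities
    say exactly that they are intertwined with the original structure:
      N [x, y]_N = [N x, N y]   and   S (theta_x v) = rho_(N x) (S v)
    (nij_ns_bracketE and nij_ns_thetaE).

    The identities required of the induced objects are of two kinds.  Those for
    l, r and the product <> carry N or S on the arguments; after collecting
    terms, they are the defining identities of the Nijenhuis data evaluated at
    N x, S a or S b, transported along the two formulas above.  Those for psi
    and the bracket carry N or S outside: the Nijenhuis identities write every
    term of the identity as a value of the same operator, and under that
    operator it is the sum of the original identity at all ways of applying
    N or S to one of its arguments, minus N or S of the original identity itself.

    Two symmetries shorten the work.  A Nijenhuis Lie algebra is a Nijenhuis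
    representation of itself, so the first NS-Lie axiom is an instance of the
    first axiom of representations.  A matched pair stays one when its two
    halves are exchanged (nijenhuis_matched_pair_sym), so only the identities
    for l, r, psi have to be proved. *)

Set Implicit Arguments.
Unset Strict Implicit.
Unset Printing Implicit Defensive.

Import GRing.Theory.
Local Open Scope ring_scope.

(** * Additive identities *)

(** Returns y if x and y are opposite atoms.  Like [opposite_in], it matches
    only the atom under the opposite: the instance of the opposite in the goal
    need not be syntactically the one that elaborating - x would produce. *)
Ltac opposite x y :=
  match y with
  | - x => y
  | _ => match x with - y => y end
  end.

Ltac opposite_in x T :=
  match T with
  | ?y + _ => opposite x y
  | _ + ?T' => opposite_in x T'
  | _ => opposite x T
  end.

Ltac summand_first y T :=
  match T with
  | y => idtac
  | y + _ => idtac
  | ?z + y => rewrite (addrC z y)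
  | ?z + ?T' => summand_first y T'; rewrite (addrCA z y)
  end.

(** Moves everything to one side and cancels the leading summand against its
    opposite until nothing is left.  Atoms are compared syntactically, so linear
    and bilinear maps have to be distributed over sums beforehand. *)
Ltac cancel_summands :=
  apply/eqP; rewrite -subr_eq0; apply/eqP;
  rewrite ?(opprD, opprK, addr0, add0r, oppr0) -?addrA;
  repeat match goal with
  | |- ?x + ?T = 0 =>
      let y := opposite_in x T in
      summand_first y T; rewrite ?(addKr, addNKr, addNr, addrN)
  end; try reflexivity.

Section Additivity.
Variable K : fieldType.

Lemma bilinear_opE (U V W : lmodType K) (f : U -> V -> W) : bilinear_op f ->
  ((forall x y v, f (x + y)%R v = (f x v + f y v)%R) *
   (forall x v w, f x (v + w)%R = (f x v + f x w)%R) *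
   (forall x v, f (- x) v = - f x v) * (forall x v, f x (- v) = - f x v))%type.
Proof.
move=> [fl fr].
have fDl x y v : f (x + y) v = f x v + f y v.
  by have := fl v 1 x y; rewrite /= !scale1r.
have fDr x v w : f x (v + w) = f x v + f x w.
  by have := fr x 1 v w; rewrite /= !scale1r.
have f0l v : f 0 v = 0 by apply: (addrI (f 0 v)); rewrite -fDl !addr0.
have f0r x : f x 0 = 0 by apply: (addrI (f x 0)); rewrite -fDr !addr0.
split=> [|x v]; last by apply/eqP; rewrite -addr_eq0 -fDr addNr f0r.
by split=> // x v; apply/eqP; rewrite -addr_eq0 -fDl addNr f0l.
Qed.

Lemma linear_opE (U V : lmodType K) (f : U -> V) : linear f ->
  ((forall x y, f (x + y)%R = (f x + f y)%R) * (forall x, f (- x) = - f x))%type.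
Proof.
move=> fL.
have fD x y : f (x + y) = f x + f y by have := fL 1 x y; rewrite !scale1r.
have f0 : f 0 = 0 by apply: (addrI (f 0)); rewrite -fD !addr0.
by split=> // x; apply/eqP; rewrite -addr_eq0 -fD addNr f0.
Qed.

Section Composition.
Variables (U V W : lmodType K) (f : U -> V -> W).
Hypothesis fB : bilinear_op f.

Lemma bilinear_op_compl (T : lmodType K) (N : T -> U) :
  linear N -> bilinear_op (fun x v => f (N x) v).
Proof.
move=> NL; case: fB => fl fr; split=> [v c x y | x c v w] /=.
  by rewrite NL; exact: fl.
exact: fr.
Qed.

Lemma bilinear_op_compr (T : lmodType K) (S : T -> V) :
  linear S -> bilinear_op (fun x v => f x (S v)).
Proof.
move=> SL; case: fB => fl fr; split=> [v c x y | x c v w] /=.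
  exact: fl.
by rewrite SL; exact: fr.
Qed.

Lemma bilinear_op_comp (T : lmodType K) (S : W -> T) :
  linear S -> bilinear_op (fun x v => S (f x v)).
Proof.
move=> SL; case: fB => fl fr; split=> [v c x y | x c v w] /=.
  by rewrite (fl v c x y) SL.
by rewrite (fr x c v w) SL.
Qed.

Lemma bilinear_op_opp : bilinear_op (fun x v => - f x v).
Proof.
case: fB => fl fr; split=> [v c x y | x c v w] /=.
  by rewrite (fl v c x y) opprD scalerN.
by rewrite (fr x c v w) opprD scalerN.
Qed.

End Composition.
End Additivity.

(** * Representations of the induced NS-Lie algebra *)

Section InducedRepresentation.
Variables (K : fieldType) (g V : lmodType K).
Variables (br : g -> g -> g) (N : g -> g) (rho : g -> V -> V) (S : V -> V).
Hypothesis gN : nijenhuis_lie_algebra br N.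
Hypothesis VS : nijenhuis_representation br N rho S.

Let brE := bilinear_opE (lie_bilinear (nij_lie gN)).
Let NE := linear_opE (nij_linear gN).
Let rhoE := bilinear_opE (lie_rep_bilinear (nij_rep_lie VS)).
Let SE := linear_opE (nij_rep_linear VS).

Lemma lie_antisym x y : br x y = - br y x.
Proof.
have := lie_alternating (nij_lie gN) (x + y).
rewrite !brE !(lie_alternating (nij_lie gN)) add0r addr0.
by move/eqP; rewrite addr_eq0 => /eqP.
Qed.

Lemma nij_ns_bracket_def x y :
  ns_bracket (nij_dia br N) (nij_flo br N) x y =
    br (N x) y + br x (N y) - N (br x y).
Proof. by rewrite /ns_bracket /nij_dia /nij_flo (lie_antisym (N y)) opprK. Qed.

Lemma nij_ns_bracketE x y :
  N (ns_bracket (nij_dia br N) (nij_flo br N) x y) = br (N x) (N y).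
Proof. by rewrite nij_ns_bracket_def (nij_eq gN). Qed.

Lemma nij_ns_theta_def x v :
  ns_theta (fun x v => rho (N x) v) (fun x v => - rho x (S v))
    (fun x v => - S (rho x v)) x v = rho (N x) v + rho x (S v) - S (rho x v).
Proof. by rewrite /ns_theta opprK. Qed.

Lemma nij_ns_thetaE x v :
  S (ns_theta (fun x v => rho (N x) v) (fun x v => - rho x (S v))
       (fun x v => - S (rho x v)) x v) = rho (N x) (S v).
Proof. by rewrite nij_ns_theta_def (nij_rep_eq VS). Qed.

Lemma nij_ns_representation :
  ns_representation (nij_dia br N) (nij_flo br N)
    (fun x v => rho (N x) v) (fun x v => - rho x (S v))
    (fun x v => - S (rho x v)).
Proof.
have rhoB := lie_rep_bilinear (nij_rep_lie VS).
have rhobr := lie_rep_bracket (nij_rep_lie VS).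
split.
- exact: bilinear_op_compl (nij_linear gN).
- exact: bilinear_op_opp (bilinear_op_compr rhoB (nij_rep_linear VS)).
- exact: bilinear_op_opp (bilinear_op_comp rhoB (nij_rep_linear VS)).
- move=> x y v.
  (* The terms outside the commutator form rho at N [x, y]_N = [N x, N y]. *)
  have -> : rho (N (nij_dia br N x y)) v =
      rho (N x) (rho (N y) v) - rho (N y) (rho (N x) v)
        + rho (N (nij_dia br N y x)) v - rho (N (nij_flo br N x y)) v.
    rewrite -rhobr -nij_ns_bracketE /ns_bracket /nij_flo !(NE, rhoE).
    by cancel_summands.
  by cancel_summands.
- move=> x y v.
  (* rho_y is applied to S (theta_x v) = rho_(N x) (S v). *)
  have := nij_rep_eq VS x v; rewrite !SE => SrhoN.
  have rhoS : rho y (rho (N x) (S v)) =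
      rho y (S (rho (N x) v)) + rho y (S (rho x (S v))) - rho y (S (S (rho x v))).
    by rewrite SrhoN !rhoE.
  rewrite /nij_dia rhobr rhoS !(SE, rhoE).
  by cancel_summands.
- move=> x y v.
  rewrite !nij_ns_theta_def nij_ns_bracket_def /nij_flo.
  rewrite !(rhoE, SE, nij_rep_eq VS, rhobr).
  by cancel_summands.
Qed.

End InducedRepresentation.

(** * The induced NS-Lie algebra *)

Section InducedAlgebra.
Variables (K : fieldType) (g : lmodType K) (br : g -> g -> g) (N : g -> g).
Hypothesis gN : nijenhuis_lie_algebra br N.

Let brE := bilinear_opE (lie_bilinear (nij_lie gN)).
Let NE := linear_opE (nij_linear gN).

Lemma nijenhuis_adjoint : nijenhuis_representation br N br N.
Proof.
split; [split | exact: nij_linear gN | exact: nij_eq gN].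
  exact: lie_bilinear (nij_lie gN).
move=> x y z; have /eqP := lie_jacobi (nij_lie gN) x y z.
rewrite (lie_antisym gN z x) (lie_antisym gN z (br x y)) brE.
by rewrite subr_eq0 eq_sym => /eqP.
Qed.

Lemma nij_ns_lie_algebra : ns_lie_algebra (nij_dia br N) (nij_flo br N).
Proof.
have brB := lie_bilinear (nij_lie gN); split.
- exact: bilinear_op_compl (nij_linear gN).
- exact: bilinear_op_opp (bilinear_op_comp brB (nij_linear gN)).
- by move=> x y; rewrite /nij_flo (lie_antisym gN) NE.
- exact: ns_rep_l_eq (nij_ns_representation gN nijenhuis_adjoint).
- move=> x y z.
  have jacobi a b c : br c (br a b) = - br a (br b c) - br b (br c a).
    have /eqP := lie_jacobi (nij_lie gN) a b c.
    by rewrite addrC addr_eq0 opprD => /eqP.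
  rewrite !(nij_ns_bracket_def gN) /nij_flo /nij_dia.
  rewrite !(brE, NE, nij_eq gN).
  (* The identity is N applied to the Jacobi identity at these four triples. *)
  rewrite (jacobi (N x) y z) (jacobi x (N y) z) (jacobi x y (N z)) (jacobi x y z).
  rewrite !NE.
  by cancel_summands.
Qed.

End InducedAlgebra.

(** * Matched pairs *)

Lemma nijenhuis_matched_pair_sym (K : fieldType) (g h : lmodType K)
    (brg : g -> g -> g) (N : g -> g) (brh : h -> h -> h) (S : h -> h)
    (rho : g -> h -> h) (nu : h -> g -> g) :
  nijenhuis_matched_pair brg N brh S rho nu ->
  nijenhuis_matched_pair brh S brg N nu rho.
Proof. by case; split. Qed.

Section MatchedPair.
Variables (K : fieldType) (g h : lmodType K).
Variables (brg : g -> g -> g) (N : g -> g) (brh : h -> h -> h) (S : h -> h).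
Variables (rho : g -> h -> h) (nu : h -> g -> g).
Hypothesis hmp : nijenhuis_matched_pair brg N brh S rho nu.

Let gN := nij_mp_left hmp.
Let hS := nij_mp_right hmp.
Let rhoS := nij_mp_rho hmp.
Let nuN := nij_mp_nu hmp.
Let brhE := bilinear_opE (lie_bilinear (nij_lie hS)).
Let SE := linear_opE (nij_linear hS).
Let rhoE := bilinear_opE (lie_rep_bilinear (nij_rep_lie rhoS)).

Let l (x : g) (a : h) := rho (N x) a.
Let r (x : g) (a : h) := - rho x (S a).
Let psi (x : g) (a : h) := - S (rho x a).
Let L (a : h) (x : g) := nu (S a) x.
Let R (a : h) (x : g) := - nu a (N x).
Let Psi (a : h) (x : g) := - N (nu a x).

(** The derivation-type identity for rho_(N x) at [S a, b], in which S and N of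
    thetas are recognised. *)
Lemma nij_mp_l_dia x a b :
  l x (nij_dia brh S a b) =
    nij_dia brh S (l x a) b + nij_dia brh S a (l x b)
      + nij_dia brh S (psi x a) b - nij_dia brh S (r x a) b
      + r (R b x) a - l (ns_theta L R Psi a x) b.
Proof.
rewrite /l (nij_ns_thetaE nuN) /nij_dia (nij_mp_rho_bracket hmp).
rewrite (nij_rep_eq rhoS) /psi /r /R !(SE, brhE, rhoE).
by cancel_summands.
Qed.

(** The derivation-type identity for rho_x at [S a, S b] = S [a, b]_S. *)
Lemma nij_mp_r_bracket x a b :
  r x (ns_bracket (nij_dia brh S) (nij_flo brh S) a b) =
    nij_dia brh S a (r x b) - nij_dia brh S b (r x a)
      + r (L b x) a - r (L a x) b.
Proof.
rewrite /r (nij_ns_bracketE hS) (nij_mp_rho_bracket hmp) /nij_dia /L.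
rewrite (lie_antisym hS _ (S b)) !brhE.
by cancel_summands.
Qed.

(** Every term is S of something, and under S the identity is the sum of the
    derivation-type identities at (N x, a, b), (x, S a, b) and (x, a, S b),
    minus S of the one at (x, a, b). *)
Lemma nij_mp_l_flo x a b :
  l x (nij_flo brh S a b) =
    nij_flo brh S (ns_theta l r psi x a) b
      + nij_flo brh S a (ns_theta l r psi x b)
      + psi (ns_theta L R Psi b x) a - psi (ns_theta L R Psi a x) b
      + nij_dia brh S a (psi x b) - nij_dia brh S b (psi x a)
      + r (Psi a x) b - r (Psi b x) a
      - psi x (ns_bracket (nij_dia brh S) (nij_flo brh S) a b).
Proof.
rewrite (nij_ns_bracket_def hS) /ns_theta /nij_flo /nij_dia /l /r /psi /L /R /Psi.
rewrite !(SE, brhE, rhoE, nij_eq hS, nij_rep_eq rhoS, nij_mp_rho_bracket hmp).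
(* Brings all brackets with b to the form [_, b]. *)
rewrite !(lie_antisym hS b) !(lie_antisym hS (S b)) !(SE, brhE).
by cancel_summands.
Qed.

End MatchedPair.

Theorem proposition6p29 (K : fieldType) (g h : lmodType K)
    (brg : g -> g -> g) (N : g -> g) (brh : h -> h -> h) (S : h -> h)
    (rho : g -> h -> h) (nu : h -> g -> g)
    (hmp : nijenhuis_matched_pair brg N brh S rho nu) :
  ns_matched_pair (nij_dia brg N) (nij_flo brg N)
    (nij_dia brh S) (nij_flo brh S)
    (fun (x : g) (a : h) => rho (N x) a)
    (fun (x : g) (a : h) => - rho x (S a))
    (fun (x : g) (a : h) => - S (rho x a))
    (fun (a : h) (x : g) => nu (S a) x)
    (fun (a : h) (x : g) => - nu a (N x))
    (fun (a : h) (x : g) => - N (nu a x)).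
Proof.
have hmp' := nijenhuis_matched_pair_sym hmp.
split.
- exact: nij_ns_lie_algebra (nij_mp_left hmp).
- exact: nij_ns_lie_algebra (nij_mp_right hmp).
- exact: nij_ns_representation (nij_mp_left hmp) (nij_mp_rho hmp).
- exact: nij_ns_representation (nij_mp_right hmp) (nij_mp_nu hmp).
- exact: nij_mp_l_dia hmp.
- exact: nij_mp_r_bracket hmp.
- exact: nij_mp_l_dia hmp'.
- exact: nij_mp_r_bracket hmp'.
- exact: nij_mp_l_flo hmp.
- exact: nij_mp_l_flo hmp'.
Qed.
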